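(* Let $\hat b=(\hat b^1,\dots,\hat b^q)^T$ be a random element of $S=[L^1(0,1)]^q$ whose coordinates $\hat b^i\in L^1(0,1)$ are second order processes, that is, $\mathrm{E}\{(\hat b^i(p))^2\}<\infty$ for each $p\in(0,1)$. Let $0=\lambda_0<\lambda_1<\dots<\lambda_K=1$ and let $\hat B_k^i=\int_{\lambda_{k-1}}^{\lambda_k}\hat b^i(p)\,\mathrm{d}p$. Then for $k=1,\dots,K$, $$\mathrm{Var}(\hat B_k^i)\le(\lambda_k-\lambda_{k-1})\int_{\lambda_{k-1}}^{\lambda_k}\mathrm{Var}\{\hat b^i(p)\}\,\mathrm{d}p\quad\text{for } i=1,\dots,q.$$
   Context: $S=[L^1(0,1)]^q$ is the $q$-dimensional product of $L^1(0,1)$ with norm $\lVert b\rVert_S=\sum_{i=1}^q\lVert b^i\rVert_{L^1}$. The setting: $Y_1,\dots,Y_n$ are independent replicates of a real random variable $Y$ with $\mathrm{E}(Y)<\infty$, with fixed given covariate vectors $x_1,\dots,x_n\in\mathbb{R}^m$; the conditional quantile function of $Y$ given $x$ is modeled as $Q(p|x)=t(x)^Tb(p)$, with $t:\mathbb{R}^m\to\mathbb{R}^q$ a transformation of $x$ and $b:(0,1)\to\mathbb{R}^q$ coordinate-wise integrable. $\hat b$ is an estimator of $b$, i.e. a random element of $S$ computed from the sample $\{(Y_j,x_j)\}_{j=1}^n$.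
   Formalization: Since elements of L^1(0,1) have no values at individual p, each coordinate of the random element is taken with a pointwise version that is jointly measurable in the outcome and p, and the second order condition is imposed on that version. *)

(* Defs.v *)
From HB Require Import structures.
From mathcomp Require Export all_boot all_order all_algebra.
From mathcomp Require Export all_classical all_reals all_analysis.

Set Implicit Arguments.
Unset Strict Implicit.
Unset Printing Implicit Defensive.
Import Order.TTheory GRing.Theory Num.Theory.
Import numFieldNormedType.Exports.

Local Open Scope classical_set_scope.
Local Open Scope ring_scope.

(* Functions on (0, 1) are represented by functions on R; the measure below
   ignores everything outside (0, 1). *)
Definition leb01 (R : realType) : {measure set (measurableTypeR R) -> \bar R} :=
  mrestr (@lebesgue_measure R) (measurable_itv `]0, 1[%R).

Definition L1_01 (R : realType) : Type := LspaceType1 (leb01 R).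

Definition Sspace (R : realType) (q : nat) : Type := 'I_q -> L1_01 R.

(* The library's [LspaceType] has no linear structure, so the distance
   ||f - g||_S is computed on representatives; it does not depend on the
   choice of representatives. *)
Definition Sdist (R : realType) (q : nat) (f g : Sspace R q) : \bar R :=
  (\sum_(i < q) 'N[leb01 R]_1[EFin \o (fun p => f i p - g i p)%R])%E.

Definition Sopen (R : realType) (q : nat) : set (set (Sspace R q)) :=
  [set U | forall f, U f ->
    exists2 e : R, 0 < e & forall g, (Sdist f g < e%:E)%E -> U g].

(* Borel measurability for the norm topology of S. *)
Definition random_element (R : realType) (q : nat) (d : measure_display)
    (T : measurableType d) (X : T -> Sspace R q) : Prop :=
  forall A, <<s @Sopen R q >> A -> measurable (X @^-1` A).

(* Points of [Sspace] are a.e.-classes and have no values at individual p, so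
   speaking of the coordinates of X as processes requires a pointwise version
   b i p w of (X w i)(p).  Joint measurability is what gives Fubini's theorem
   a meaning: if b were only measurable in w for each fixed p, the variances
   of the b i p would not constrain those of the integrals of X (Sierpinski's
   example under the continuum hypothesis). *)
Definition coordinate_processes (R : realType) (q : nat) (d : measure_display)
    (T : measurableType d) (X : T -> Sspace R q) (b : 'I_q -> R -> T -> R)
    : Prop :=
  forall i : 'I_q,
    measurable_fun ([set: T] `*` (`]0, 1[ : set (measurableTypeR R)))
      (fun z : T * measurableTypeR R => b i z.2 z.1) /\
    (forall w : T, {ae leb01 R, forall p, X w i p = b i p w}).

Definition second_order (R : realType) (q : nat) (d : measure_display)
    (T : measurableType d) (P : probability T R) (b : 'I_q -> R -> T -> R)
    : Prop :=
  forall (i : 'I_q) (p : R), 0 < p < 1 ->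
    ('E_P[(fun w => b i p w ^+ 2)%R] < +oo)%E.

(* Main.v *)
(* If the integral of p |-> Var (b p) is infinite there is nothing to prove.
   Otherwise the centred process b - E b is square integrable for the product
   measure, so the mean function E b is integrable as the difference of two
   integrable functions, and Fubini's theorem identifies B - E B with the
   integral of b - E b.  The Cauchy-Schwarz inequality in p followed by
   Tonelli's theorem gives the bound. *)

Require Import Defs.
From mathcomp Require Import measurable_realfun ring lra.
Set Implicit Arguments.
Unset Strict Implicit.
Unset Printing Implicit Defensive.
Import Order.TTheory GRing.Theory Num.Theory.
Import numFieldNormedType.Exports.
Local Open Scope classical_set_scope.
Local Open Scope ring_scope.

(** * Square integrability and Cauchy-Schwarz on a finite measure space *)

Lemma integrable_of_sqr (d : measure_display) (T : measurableType d)
    (R : realType) (mu : {measure set T -> \bar R}) (g : T -> R) :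
  (mu [set: T] < +oo)%E -> measurable_fun [set: T] g ->
  mu.-integrable [set: T] (EFin \o (fun x => g x ^+ 2)) ->
  mu.-integrable [set: T] (EFin \o g).
Proof.
move=> muoo mg ig2.
have ic : mu.-integrable [set: T] (cst 1%:E).
  apply/integrableP; split => //.
  by rewrite integral_cst//= normr1 mul1e.
apply: le_integrable (integrableD measurableT ic ig2) => //.
  exact/measurable_EFinP.
move=> x _ /=; rewrite lee_fin [leRHS]ger0_norm; last first.
  by rewrite addr_ge0// sqr_ge0.
(* The dominating function is [1 + g ^+ 2]: expanding [(|g| - 1)^2 >= 0] gives
   [2 |g| <= 1 + g^2]. *)
rewrite -real_normK ?num_real//.
by have := sqr_ge0 (`|g x| - 1); have := normr_ge0 (g x); nra.
Qed.

(** Cauchy-Schwarz against the constant 1, in the form that the squared deviation of [g] from its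
    mean has nonnegative integral. When [g ^+ 2] is not integrable the right side is [+oo], since
    [mu] has positive mass. *)
Lemma sqr_Rintegral_le (d : measure_display) (T : measurableType d)
    (R : realType) (mu : {finite_measure set T -> \bar R}) (g : T -> R) :
  (0 < mu [set: T])%E -> measurable_fun [set: T] g ->
  (((\int[mu]_x g x) ^+ 2)%:E <= mu [set: T] * \int[mu]_x (g x ^+ 2)%:E)%E.
Proof.
move=> mu0 mg.
have mg2 : measurable_fun [set: T] (EFin \o (fun x => g x ^+ 2)).
  exact/measurable_EFinP/measurable_funX.
have g2ge0 x : (0 <= (g x ^+ 2)%:E)%E by rewrite lee_fin sqr_ge0.
have [ig2|nig2] :=
    boolP (mu.-integrable [set: T] (EFin \o (fun x => g x ^+ 2))); last first.
  suff -> : (\int[mu]_x (g x ^+ 2)%:E = +oo)%E by rewrite gt0_muley// leey.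
  apply/eqP; rewrite -leye_eq leNgt; apply: contra nig2 => ioo.
  apply/integrableP; split => //.
  rewrite (eq_integral (fun x => (g x ^+ 2)%:E))// => x _ /=.
  by rewrite ger0_norm// sqr_ge0.
have muoo : (mu [set: T] < +oo)%E by rewrite ltey_eq fin_num_measure.
have ig := integrable_of_sqr muoo mg ig2.
set M := fine (mu [set: T]).
have ME : mu [set: T] = M%:E by rewrite fineK// fin_num_measure.
have M0 : 0 < M by rewrite -lte_fin -ME.
have -> : (\int[mu]_x (g x ^+ 2)%:E)%E = (\int[mu]_x (g x ^+ 2))%:E.
  by rewrite fineK//; exact: (integrable_fin_num measurableT ig2).
rewrite ME -EFinM lee_fin.
set I := \int[mu]_x g x; set J := \int[mu]_x (g x ^+ 2).
pose c := I / M.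
have icg : mu.-integrable [set: T] (EFin \o (fun x => - (2 * c) * g x)).
  exact: (integrableZl measurableT (- (2 * c)) ig).
have ic := finite_measure_integrable_cst mu (c ^+ 2)
  (measurableT : measurable [set: T]).
(* The integral of [(g - c) ^+ 2], with [c] the mean of [g]. *)
have : 0 <= \int[mu]_x (g x ^+ 2 + (- (2 * c) * g x + c ^+ 2)).
  apply: Rintegral_ge0 => x _.
  by have := sqr_ge0 (g x - c); congr (0 <= _); ring.
rewrite RintegralD//; last exact: (integrableD measurableT icg ic).
rewrite RintegralD// RintegralZl// Rintegral_cst// -/I -/J -/M /c.
move=> h; rewrite -subr_ge0.
(* With [c = I / M] the expanded integral is [J - I^2 / M]; multiplying by [M] clears the
   denominator. *)
rewrite (_ : _ - _ =
  M * (J + (- (2 * (I / M)) * I + (I / M) ^+ 2 * M))).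
  by rewrite mulr_ge0// ltW.
by field; rewrite gt_eqF.
Qed.

(** * Variance of an integral over a finite measure space *)

Lemma varianceE_integral (d : measure_display) (T : measurableType d)
    (R : realType) (P : probability T R) (X : T -> R) :
  'V_P[X]%E = (\int[P]_w ((X w - fine 'E_P[X]) ^+ 2)%:E)%E.
Proof.
by rewrite /variance !unlock; apply: eq_integral => w _ /=; rewrite expr2.
Qed.

(** Integrability is assumed of the sections of [f] only. Joint integrability is derived for the
    centred [g], in the case where the right side is finite. *)
Lemma variance_Rintegral_le (d1 d2 : measure_display) (T : measurableType d1)
    (Y : measurableType d2) (R : realType) (P : probability T R)
    (mu : {finite_measure set Y -> \bar R}) (f : T * Y -> R) :
  (0 < mu [set: Y])%E -> measurable_fun [set: T * Y] f ->
  (forall w, mu.-integrable [set: Y] (fun y => (f (w, y))%:E)) ->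
  (forall y, P.-integrable [set: T] (fun w => (f (w, y))%:E)) ->
  ('V_P[fun w => (\int[mu]_y f (w, y))%R] <=
     mu [set: Y] * \int[mu]_y 'V_P[fun w => f (w, y)])%E.
Proof.
move=> mu0 mf ify ifw.
pose m (y : Y) : R := fine 'E_P[fun w => f (w, y)]%E.
have mm : measurable_fun [set: Y] m.
  apply: measurableT_comp => //.
  (* Tonelli gives measurability of partial integrals of nonnegative functions, so the mean is split
     into its positive and negative parts. *)
  rewrite [X in measurable_fun _ X](_ : _ = fun y =>
    \int[P]_w ((EFin \o f)^\+ (w, y)) -
    \int[P]_w ((EFin \o f)^\- (w, y)))%E; last first.
    apply/funext => y; rewrite unlock [LHS]integralE.
    by congr (_ - _)%E; apply: eq_integral => w _; rewrite ?funeposE ?funenegE.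
  have mEf : measurable_fun [set: T * Y] (EFin \o f) by exact/measurable_EFinP.
  apply: emeasurable_funB.
  - apply: (measurable_fun_fubini_tonelli_G (m1 := P) (EFin \o f)^\+%E) => //.
    exact: measurable_funepos.
  - apply: (measurable_fun_fubini_tonelli_G (m1 := P) (EFin \o f)^\-%E) => //.
    exact: measurable_funeneg.
pose g (z : T * Y) : R := f z - m z.2.
have mg : measurable_fun [set: T * Y] g.
  apply: measurable_funB => //; exact: measurableT_comp.
have mg2 : measurable_fun [set: T * Y] (fun z => (g z ^+ 2)%:E).
  exact/measurable_EFinP/measurable_funX.
have g20 z : (0 <= (g z ^+ 2)%:E)%E by rewrite lee_fin sqr_ge0.
have VE : (\int[mu]_y 'V_P[fun w => f (w, y)] =
    \int[P]_w \int[mu]_y (g (w, y) ^+ 2)%:E)%E.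
  rewrite (fubini_tonelli (fun z => (g z ^+ 2)%:E))//.
  by apply: eq_integral => y _; rewrite varianceE_integral.
rewrite VE.
have [ig2|nig2] := boolP ((P \x mu)%E.-integrable [set: T * Y]
    (EFin \o (fun z => g z ^+ 2))); last first.
  (* The integrand is nonnegative, so a finite iterated integral would make it jointly integrable;
     [mu0] rules out a product [0 * +oo]. *)
  suff -> : (\int[P]_w \int[mu]_y (g (w, y) ^+ 2)%:E = +oo)%E.
    by rewrite gt0_muley// leey.
  apply/eqP; rewrite -leye_eq leNgt; apply: contra nig2 => ioo.
  apply/integrable12ltyP => //=.
  under eq_integral do under eq_integral do rewrite ger0_norm ?sqr_ge0//.
  exact: ioo.
have muoo : (mu [set: Y] < +oo)%E by rewrite ltey_eq fin_num_measure.
have igy w : measurable_fun [set: Y] (fun y => g (w, y)).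
  exact: measurable_fun_pair2.
(* [m] itself could a priori fail to be integrable; for almost every [w] it is
   the difference of the integrable [f (w, -)] and the square-integrable
   [g (w, -)]. *)
have im : mu.-integrable [set: Y] (EFin \o m).
  (* As [P] has positive mass, a property that holds almost surely has a witness [w]. *)
  have Pp : ProperFilter (almost_everywhere P).
    have P0 : (0 < P [set: T])%E by rewrite probability_setT.
    exact: ae_properfilter_algebraOfSetsType P0.
  have [w ig2w] := filter_ex (ae_integrable1 ig2).
  have := integrableB measurableT (ify w) (integrable_of_sqr muoo (igy w) ig2w).
  apply: eq_integrable => // y _ /=.
  by rewrite -EFinB /g; congr EFin; ring.
have ig w : mu.-integrable [set: Y] (EFin \o (fun y => g (w, y))).
  exact: (integrableB measurableT (ify w) im).
have igP : (P \x mu)%E.-integrable [set: T * Y] (EFin \o g).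
  apply: integrable_of_sqr => //.
  rewrite -setXTT [ltLHS]product_measure1E// lte_mul_pinfty//.
  exact: fin_num_measure.
(* By [ifw] the mean of each section is finite, so [fine] in [m] does not replace it by the default
   0. *)
have Eg y : (\int[P]_w (g (w, y))%:E = 0)%E.
  under eq_integral do rewrite /g EFinB.
  rewrite integralB//; last exact: (finite_measure_integrable_cst P (m y)).
  rewrite [X in (_ - X)%E](integral_cst P measurableT (m y)%:E)/=.
  rewrite probability_setT mule1 /m unlock fineK ?subee//.
    exact: integrable_fin_num.
  exact: integrable_fin_num.
have intE w : (\int[mu]_y g (w, y))%:E = (\int[mu]_y (g (w, y))%:E)%E.
  by rewrite fineK//; exact: (integrable_fin_num measurableT (ig w)).
have BE w : \int[mu]_y f (w, y) = \int[mu]_y g (w, y) + \int[mu]_y m y.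
  by rewrite -RintegralD//; apply: eq_Rintegral => y _; rewrite /g subrK.
have iG : P.-integrable [set: T] (EFin \o (fun w => \int[mu]_y g (w, y))).
  have := integrable_fubini_F igP.
  by apply: eq_integrable => // w _ /=; rewrite intE.
(* After the exchange of integrals allowed by [igP], the inner integral over [P] vanishes by [Eg],
   leaving the integral of [m]. *)
have EB : fine 'E_P[fun w => (\int[mu]_y f (w, y))%R]%E = \int[mu]_y m y.
  rewrite unlock; under eq_integral do rewrite BE EFinD.
  rewrite integralD//; last first.
    exact: (finite_measure_integrable_cst P (\int[mu]_y m y)).
  rewrite [X in (_ + X)%E](integral_cst P measurableT (\int[mu]_y m y)%:E)/=.
  under eq_integral do rewrite intE.
  rewrite (Fubini igP)/= integral0_eq//.
  by rewrite add0e probability_setT mule1.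
rewrite varianceE_integral EB.
under eq_integral do rewrite BE addrK.
have mG2 := measurable_fun_fubini_tonelli_F (m2 := mu) _ mg2 g20.
rewrite -ge0_integralZl//; last by move=> w _; apply: integral_ge0.
apply: ge0_le_integral => //.
- by move=> w _; rewrite lee_fin sqr_ge0.
- apply/measurable_EFinP/measurable_funX/measurable_EFinP.
  exact: measurable_int iG.
- exact: measurable_funeM.
- by move=> w _; exact: sqr_Rintegral_le.
Qed.

(** * Passage to a subset of finite measure *)

Lemma integral_mfrestr (d : measure_display) (T : measurableType d)
    (R : realType) (mu : {measure set T -> \bar R}) (D : set T)
    (mD : measurable D) (muD : (mu D < +oo)%E) (f : T -> \bar R) :
  (\int[mfrestr mD muD]_x (f \_ D) x = \int[mu]_(x in D) f x)%E.
Proof.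
rewrite -integral_mkcond; apply: eq_measure_integral => A mA AD.
by rewrite /= /mfrestr /mrestr setIidl.
Qed.

(** Restricting [mu] to [D] yields a finite measure on all of [Y]; [f], controlled only over [D], is
    extended by zero. *)
Lemma variance_Rintegral_le_on (d1 d2 : measure_display)
    (T : measurableType d1) (Y : measurableType d2) (R : realType)
    (P : probability T R) (mu : {measure set Y -> \bar R}) (D : set Y)
    (f : T * Y -> R) :
  measurable D -> (0 < mu D < +oo)%E ->
  measurable_fun ([set: T] `*` D) f ->
  (forall w, mu.-integrable D (fun y => (f (w, y))%:E)) ->
  (forall y, D y -> P.-integrable [set: T] (fun w => (f (w, y))%:E)) ->
  ('V_P[fun w => (\int[mu]_(y in D) f (w, y))%R] <=
     mu D * \int[mu]_(y in D) 'V_P[fun w => f (w, y)])%E.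
Proof.
move=> mD /andP[mu0 muoo] mf ify ifw.
pose nu : {finite_measure set Y -> \bar R} := mfrestr mD muoo.
pose fD := f \_ ([set: T] `*` D).
have fDE w : (fun y => (fD (w, y))%:E) = (fun y => (f (w, y))%:E) \_ D.
  by apply/funext => y; rewrite /fD !patchE in_setX in_setT/=; case: ifP.
have nuT : nu [set: Y] = mu D by rewrite /nu/= /mfrestr /mrestr setTI.
have mfD : measurable_fun [set: T * Y] fD.
  by apply/(measurable_restrictT _ _).1 => //; exact: measurableX.
have := @variance_Rintegral_le _ _ T Y R P nu fD.
rewrite nuT => /(_ mu0 mfD).
have -> : (\int[nu]_y 'V_P[fun w => fD (w, y)] =
    \int[mu]_(y in D) 'V_P[fun w => f (w, y)])%E.
  rewrite -(integral_mfrestr mD muoo); apply: eq_integral => y _.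
  rewrite patchE /fD; case: ifPn => yD.
    by congr ('V_P[_])%E; apply/funext => w; rewrite patchE in_setX in_setT yD.
  (* Off [D] the section of [fD] is the constant 0, whose variance 0 is also the value of the
     restricted function there. *)
  rewrite -[RHS](variance_cst P 0); congr ('V_P[_])%E.
  by apply/funext => w; rewrite patchE in_setX in_setT (negbTE yD).
have -> : (fun w => \int[nu]_y fD (w, y)) =
    (fun w => \int[mu]_(y in D) f (w, y)).
  by apply/funext => w; rewrite /Rintegral fDE integral_mfrestr.
apply.
- move=> w; apply/integrableP; split.
    by apply/measurable_EFinP; exact: measurable_fun_pair2.
  have /integrableP[_] := ify w; rewrite -(integral_mfrestr mD muoo).
  congr (_ < _)%E; apply: eq_integral => y _.
  rewrite [RHS](congr1 (fun h => `|h y|%E) (fDE w)) !patchE.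
  by case: ifP => //; rewrite abse0.
- move=> y; rewrite /fD; have [yD|yD] := boolP (y \in D).
    apply: eq_integrable (ifw y (set_mem yD)) => // w _.
    by rewrite patchE in_setX in_setT yD.
  apply: eq_integrable (integrable0 P [set: T]) => // w _.
  by rewrite patchE in_setX in_setT (negbTE yD).
Qed.

(** * Application to the coordinate processes on the partition intervals *)

Theorem proposition4 (R : realType) (d : measure_display)
    (T : measurableType d) (P : probability T R) (q : nat)
    (X : T -> Sspace R q) (b : 'I_q -> R -> T -> R)
    (hX : random_element X) (hb : coordinate_processes X b)
    (hb2 : second_order P b)
    (K : nat) (lam : nat -> R)
    (lam0 : lam 0%N = 0) (lamK : lam K = 1)
    (lam_incr : forall k : nat, (k < K)%N -> lam k < lam k.+1)
    (B : nat -> 'I_q -> T -> R)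
    (hB : forall (k : nat) (i : 'I_q) (w : T), B k i w =
       \int[@lebesgue_measure R]_(p in `]lam k.-1, lam k[) b i p w) :
  forall k : nat, (1 <= k <= K)%N -> forall i : 'I_q,
    ('V_P[B k i] <=
       (lam k - lam k.-1)%:E *
       \int[@lebesgue_measure R]_(p in `]lam k.-1, lam k[) 'V_P[b i p])%E.
Proof.
move=> [//|k] /andP[_ kK] i /=.
(* The increase of [lam] is known up to index [K] only, hence the bound on [n]. *)
have lam_le m n : (m <= n)%N -> (n <= K)%N -> lam m <= lam n.
  elim: n => [|n IHn]; first by rewrite leqn0 => /eqP->.
  rewrite leq_eqVlt => /predU1P[->//|mn] nK.
  exact: le_trans (IHn mn (ltnW nK)) (ltW (lam_incr _ nK)).
have lamk := lam_incr _ kK.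
pose D : set (measurableTypeR R) := `]lam k, lam k.+1[%classic.
pose D01 : set (measurableTypeR R) := `]0, 1[%classic.
have mD : measurable D by exact: measurable_itv.
have mD01 : measurable D01 by exact: measurable_itv.
have D01D : D `<=` D01.
  move=> p; rewrite /D /D01 /= !in_itv/= => /andP[kp pk]; apply/andP; split.
    by apply: le_lt_trans kp; rewrite -lam0 lam_le// ltnW.
  by apply: lt_le_trans pk _; rewrite -lamK lam_le.
have muD : lebesgue_measure D = (lam k.+1 - lam k)%:E.
  by rewrite /D lebesgue_measure_itv/= lte_fin lamk EFinB.
have [mb Xb] := hb i.
pose f (z : T * measurableTypeR R) := b i z.2 z.1.
have BE : B k.+1 i = fun w => \int[@lebesgue_measure R]_(p in D) f (w, p).
  by apply/funext => w; rewrite hB.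
rewrite -muD BE.
apply: (@variance_Rintegral_le_on _ _ T (measurableTypeR R) R P
  lebesgue_measure D f) => //.
- apply/andP; split; first by rewrite [ltRHS]muD lte_fin subr_gt0.
  by rewrite [ltLHS]muD ltry.
- apply: measurable_funS mb; first exact: measurableX.
  by move=> [w p] [_ Dp]; split=> //; exact: D01D.
(* Joint measurability makes the path of [b] measurable. Its integral is finite because it agrees
   almost everywhere with a representative of finite L1 norm, and [leb01] coincides with Lebesgue
   measure on subsets of [D]. *)
- move=> w.
  have mXw : measurable_fun D (fun p => b i p w).
    apply: (measurable_comp (F := [set: T] `*` D01) (g := pair w) _ _ mb) => //.
    + exact: measurableX.
    + by move=> _ [p Dp <-]; split=> //; exact: D01D.
    + exact: measurable_funTS.
  apply/integrableP; split; first exact/measurable_EFinP.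
  have iX : (leb01 R).-integrable D (EFin \o (X w i : R -> R)).
    apply: (integrableS measurableT) => //.
    apply/integrableP; split.
      apply/measurable_EFinP; exact: (measurable_funPT (repr
        (X w i : {mfun_ leb01 R, measurableTypeR R >-> measurableTypeR R}))).
    by rewrite -Lnorm1; exact: Lebesgue_finite.
  have /integrableP[_] := iX; congr (_ < _)%E.
  rewrite (@ae_eq_integral _ _ _ (leb01 R) D (fun p => `|(b i p w)%:E|%E)) //.
  + apply: eq_measure_integral => A mA AD.
    by rewrite /leb01/= /mrestr setIidl//; exact: subset_trans D01D.
  + apply: measurableT_comp => //; exact: (measurable_int _ iX).
  + by apply: measurableT_comp => //; exact/measurable_EFinP.
  + by apply: filterS (Xb w) => p XbE _ /=; rewrite XbE.
(* For [p] in (0, 1) the second moment is finite, and under a probability this yields a finite first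
   moment. *)
- move=> p Dp.
  have mp : measurable_fun [set: T] (b i p).
    apply: (measurable_comp (F := [set: T] `*` D01) (g := pair^~ p)
      _ _ mb) => //.
    + exact: measurableX.
    + by move=> _ [w _ <-]; split=> //; exact: D01D.
  apply: integrable_of_sqr => //; first by rewrite [ltLHS]probability_setT ltry.
  apply/integrableP; split; first exact/measurable_EFinP/measurable_funX.
  have p01 : 0 < p < 1 by have := D01D _ Dp; rewrite /D01 /= in_itv.
  have := hb2 i p p01; rewrite unlock; congr (_ < _)%E.
  by apply: eq_integral => w _ /=; rewrite ger0_norm// sqr_ge0.
Qed.
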